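(* For every $p\in(0,1)$ the process $\pi(p,v=1,r=1/2,\mathbb{Z})$ possesses a one-parameter family $\{\mu_\rho\}_{\rho\in(0,1)}$ of invariant probability measures on $\{0,1\}^{\mathbb{Z}}$ such that for each $\rho\in(0,1)$ the measure $\mu_\rho$ is positive on each nonempty open set and is supported by the set of configurations of density $\rho$.
   Context: A configuration of particles on $\mathbb{Z}$ with at most one particle per site is identified with a binary sequence in $\{0,1\}^{\mathbb{Z}}$ (1 = occupied site, 0 = empty site), with the product topology. $\pi(p,v=1,r=1/2,\mathbb{Z})$ is the discrete time Markov process on $\{0,1\}^{\mathbb{Z}}$ in which at each time step, simultaneously and independently, every particle at a site $i$ such that site $i+1$ is empty (at the beginning of the step) jumps to $i+1$ with probability $p$ and stays with probability $1-p$; all other particles stay. The density of a configuration whose particles are located at $\dots<x_0<x_1<x_2<\dots$ is $\lim_{n\to\infty}n/(x_{n-1}-x_0)$ if the limit exists. ''Supported by'' means that the set of configurations of density $\rho$ has full measure. *)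

(* Defs.v *)
From HB Require Import structures.
From mathcomp Require Import all_boot all_order all_algebra finmap.
From mathcomp Require Import ring lra zify.
From mathcomp Require Import all_classical all_reals all_analysis.
From mathcomp Require Import measurable_realfun.
Set Implicit Arguments.
Unset Strict Implicit.
Unset Printing Implicit Defensive.
Import Order.TTheory GRing.Theory Num.Theory.
Import numFieldNormedType.Exports.

Local Open Scope classical_set_scope.
Local Open Scope ring_scope.

(* Configurations on Z ([true] is an occupied site), with the product topology
   of {0,1}^Z and its Borel sigma-algebra. *)
Definition config : Type :=
  g_sigma_algebraType (@open (prod_topology (fun _ : int => bool))).

HB.instance Definition _ :=
  Topological.copy config (prod_topology (fun _ : int => bool)).
HB.instance Definition _ := Measurable.copy config
  (g_sigma_algebraType (@open (prod_topology (fun _ : int => bool)))).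

Definition cylinder (s : seq (int * bool)) : set config :=
  [set x : config | all (fun q => x q.1 == q.2) s].

Lemma open_cylinder (U : set config) (x : config) : open U -> U x ->
  exists2 s, cylinder s x & cylinder s `<=` U.
Proof.
move=> oU Ux.
pose F : set_system config :=
  [set A | exists2 s, cylinder s x & cylinder s `<=` A].
have FF : Filter F.
  split.
  - by exists [::].
  - move=> A B [r1 ? r1A] [r2 ? r2B]; exists (r1 ++ r2).
      by rewrite /cylinder/= all_cat; apply/andP; split.
    move=> y; rewrite /cylinder/= all_cat => /andP[yr1 yr2].
    by split; [exact: r1A|exact: r2B].
  - by move=> A B AB [r rx rA]; exists r => // y /rA /AB.
suff Fx : F --> (x : prod_topology (fun _ : int => bool)).
  by apply: Fx; exact: open_nbhs_nbhs.
apply/cvg_sup => i V [_ [[W oW <-] Wx WV]].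
exists [:: (i, x i)]; first by rewrite /cylinder/= eqxx.
move=> y; rewrite /cylinder/= andbT => /eqP yx; apply: WV => /=.
by rewrite /preimage/= yx.
Qed.

Lemma measurable_proj_config (i : int) :
  measurable_fun [set: config] (fun x : config => x i : bool).
Proof.
apply: (measurable_fun_bool true); rewrite setTI.
apply: sub_sigma_algebra.
apply: (@open_comp (prod_topology (fun _ : int => bool)) _ (fun x => x i)).
  by move=> x _; exact: (@proj_continuous _ (fun _ : int => bool) i x).
exact: discrete_open.
Qed.

Lemma measurable_fun_config d (T : measurableType d) (f : T -> config) :
  (forall i : int, measurable_fun [set: T] (fun t => f t i : bool)) ->
  measurable_fun [set: T] f.
Proof.
move=> mf.
have mc s : measurable (f @^-1` cylinder s).
  elim: s => [|[i b] s IH].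
    by rewrite (_ : _ @^-1` _ = setT)//; apply/seteqP; split.
  rewrite (_ : _ @^-1` _ =
      ((fun t => f t i : bool) @^-1` [set b]) `&` (f @^-1` cylinder s)).
    by apply: measurableI => //; rewrite -[X in measurable X]setTI; exact: mf.
  apply/seteqP; split => t; rewrite /cylinder /preimage /=.
    by move=> /andP[/eqP].
  by move=> [-> ->]; rewrite eqxx.
have /(_ (@open (prod_topology (fun _ : int => bool)))) := @measurability _ _ T config setT f.
apply => //.
move=> _ [U oU <-]; rewrite setTI.
pose G (n : nat) : set T :=
  [set t | exists s, [/\ choice.unpickle n = Some s, cylinder s `<=` U & cylinder s (f t)]].
rewrite (_ : f @^-1` U = \bigcup_n G n).
  apply: bigcup_measurable => n _.
  case: (pselect (exists2 s, choice.unpickle n = Some s & cylinder s `<=` U)) => [[s ns sU]|nG].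
    rewrite (_ : G n = f @^-1` cylinder s); first exact: mc.
    apply/seteqP; split => t; last by exists s.
    by move=> [s' []]; rewrite ns => -[<-].
  rewrite (_ : G n = set0); first exact: measurable0.
  by apply/seteqP; split => // t [s [ns sU _]]; apply: nG; exists s.
apply/seteqP; split => t /=.
  move=> Uft; have [s sft sU] := open_cylinder oU Uft.
  by exists (choice.pickle s) => //; exists s; split => //; exact: choice.pickleK.
by move=> [n _ [s [_ sU /sU]]].
Qed.

(* The coins are independent, and each one shows [true] with probability p. *)
Definition iid_coins (R : realType) (p : R) (Q : probability config R) : Prop :=
  forall (J : {fset int}) (a : int -> bool),
    Q [set xi : config | forall i, i \in J -> xi i = a i] =
    (\prod_(i <- J) bernoulli_pmf p (a i))%:E.

(* Existence, from a uniform variable u on [0, 1[: the n-th coin shows whether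
   the n-th iterate of u under [shift] falls below p. *)
Section iid_coins_exist.
Variables (R : realType) (p : R).
Hypothesis p01 : 0 < p < 1.

Let shift (u : R) : R := if u < p then u / p else (u - p) / (1 - p).
Let digit (n : nat) (u : R) : bool := iter n shift u < p.

Let digit_itv (n : nat) (a : nat -> bool) : exists l : R,
  [/\ 0 <= l, l + \prod_(k < n) bernoulli_pmf p (a k) <= 1 &
    forall u, 0 <= u < 1 -> (forall k, (k < n)%N -> digit k u = a k) <->
      l <= u < l + \prod_(k < n) bernoulli_pmf p (a k)].
Proof.
have [p0 p1] := andP p01; have q0 : 0 < 1 - p by rewrite subr_gt0.
elim: n a => [|n IH] a.
  by exists 0; rewrite big_ord0 add0r; split => // u ->.
have [l [l0 l1 lu]] := IH (a \o S).
rewrite big_ord_recl /=.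
rewrite (eq_bigr (fun k : 'I_n => bernoulli_pmf p ((a \o S) k))) //.
set w := \prod_(k < n) _ in l1 lu *.
have digitS u : (forall k, (k < n.+1)%N -> digit k u = a k) <->
    (u < p) = a 0%N /\ forall k, (k < n)%N -> digit k (shift u) = (a \o S) k.
  split=> [H|[H0 HS] [|k] kn].
  - by split=> [|k kn]; [exact: (H 0%N)|rewrite /= -H// /digit iterSr].
  - exact: H0.
  - by rewrite /digit iterSr; exact: HS.
case a0 : (a 0%N); rewrite /bernoulli_pmf.
- exists (p * l); split; [nra|nra|move=> u /andP[u0 u1]].
  rewrite digitS a0; split.
    move=> [up]; rewrite lu /shift up; last first.
      by rewrite divr_ge0 ?(ltW p0)//= ltr_pdivrMr// mul1r.
    rewrite ler_pdivlMr// ltr_pdivrMr// => /andP[? ?]; apply/andP; split; nra.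
  move=> /andP[lu1 lu2]; have up : u < p by nra.
  split=> //; rewrite lu /shift up; last first.
    by rewrite divr_ge0 ?(ltW p0)//= ltr_pdivrMr// mul1r.
  by rewrite ler_pdivlMr// ltr_pdivrMr//; apply/andP; split; nra.
- exists (p + (1 - p) * l); split; [nra|nra|move=> u /andP[u0 u1]].
  have sh : (u < p) = false -> 0 <= shift u < 1.
    move=> up; rewrite /shift up; move/negbT: up; rewrite -leNgt => up.
    by rewrite divr_ge0 ?subr_ge0 ?(ltW p1)//= ltr_pdivrMr// mul1r; nra.
  rewrite digitS a0; split.
    move=> [up]; rewrite lu ?sh// /shift up.
    rewrite ler_pdivlMr// ltr_pdivrMr// => /andP[? ?]; apply/andP; split; nra.
  move=> /andP[lu1 lu2]; have up : (u < p) = false.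
    by apply/negbTE; rewrite -leNgt; nra.
  split=> //; rewrite lu ?sh// /shift up.
  by rewrite ler_pdivlMr// ltr_pdivrMr//; apply/andP; split; nra.
Qed.

Let measurable_digit n : measurable_fun [set: R] (digit n).
Proof.
apply: measurable_fun_ltr => //.
elim: n => [|n IH]; first exact: measurable_id.
change (measurable_fun [set: R] (shift \o iter n shift)).
apply: measurableT_comp IH; apply: measurable_fun_ifT.
- exact: measurable_fun_ltr.
- by apply: measurable_funM.
- by apply: measurable_funM => //; exact: measurable_funB.
Qed.

Let unif : {measure set (measurableTypeR R) -> \bar R} :=
  mrestr lebesgue_measure (measurable_itv `[0 : R, 1[).

Let measurable_digits (J : {fset nat}) (a : nat -> bool) :
  measurable [set u | forall k, k \in J -> digit k u = a k].
Proof.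
rewrite (_ : [set u | _] =
    \bigcap_(k in [set k | k \in J]) (digit k @^-1` [set a k])).
  apply: bigcap_measurableType => k _.
  by rewrite -[X in measurable X]setTI; exact: measurable_digit.
by apply/seteqP; split.
Qed.

Let unif_digits (J : {fset nat}) (a : nat -> bool) :
  unif [set u | forall k, k \in J -> digit k u = a k] =
  (\prod_(k <- J) bernoulli_pmf p (a k))%:E.
Proof.
have [p0 p1] := andP p01.
have [n Jn] : exists n, forall k, k \in J -> (k < n)%N.
  exists (\max_(k <- J) k).+1 => k kJ.
  by rewrite ltnS (big_rem k)//= leq_maxl.
have [m] := ubnP (n - #|` J|)%N; elim: m => // m IH in J Jn a *.
move=> nJ; have [JE|] := pselect (forall k, (k < n)%N -> k \in J).
  have [l [l0 l1 lu]] := digit_itv n a.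
  have -> : \prod_(k <- J) bernoulli_pmf p (a k) =
      \prod_(k < n) bernoulli_pmf p (a k).
    rewrite -(big_mkord xpredT (fun k => bernoulli_pmf p (a k))).
    apply: perm_big; apply: uniq_perm; [exact: fset_uniq|exact: iota_uniq|].
    move=> k; rewrite mem_index_iota /=; apply/idP/idP => [/Jn//|]; exact: JE.
  set w := \prod_(k < n) _ in l1 lu *.
  have w0 : 0 <= w.
    by apply: prodr_ge0 => k _; apply: bernoulli_pmf_ge0; rewrite !ltW.
  rewrite /unif/= /mrestr.
  rewrite (_ : _ `&` _ = `[l, l + w[%classic).
    rewrite lebesgue_measure_itv/= lte_fin ltrDl.
    case: ltP => [_|w_le0]; first by rewrite -EFinB addrAC subrr add0r.
    by have -> : w = 0 by apply/eqP; rewrite eq_le w_le0.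
  apply/seteqP; split=> u /=; rewrite !in_itv/=.
    by move=> [H u01]; apply/(lu _ u01) => k kn; apply: H; exact: JE.
  move=> ulw; have u01 : 0 <= u < 1 by lra.
  by split=> // k /Jn; move: k; exact/lu.
move=> /existsNP[k /not_implyP[kn /negP kJ]].
have IHk (b : bool) : unif [set u | forall i, i \in (k |` J)%fset ->
      digit i u = (if i == k then b else a i)] =
    (bernoulli_pmf p b * \prod_(i <- J) bernoulli_pmf p (a i))%:E.
  rewrite IH.
  - rewrite big_fsetU1//= eqxx; congr (_ * _)%:E.
    apply: eq_big_seq => i iJ; case: eqP => // ik.
    by move: kJ; rewrite -ik iJ.
  - by move=> i; rewrite !inE => /predU1P[->//|/Jn].
  - have : (#|` (k |` J)%fset| <= n)%N.
      rewrite -[leqRHS](size_iota 0); apply: uniq_leq_size; first exact: fset_uniq.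
      by move=> i; rewrite !inE mem_iota => /predU1P[->//|/Jn].
    by move: nJ; rewrite cardfsU1 kJ; lia.
transitivity ((bernoulli_pmf p true * \prod_(i <- J) bernoulli_pmf p (a i))%:E +
    (bernoulli_pmf p false * \prod_(i <- J) bernoulli_pmf p (a i))%:E)%E; last first.
  by rewrite -EFinD -mulrDl /bernoulli_pmf addrC subrK mul1r.
rewrite -!IHk -measureU; [|exact: measurable_digits..|].
- congr (unif _); apply/seteqP; split=> u /=.
    move=> H; case ku : (digit k u); [left|right] => i; rewrite !inE;
      by case: eqP => [->|_ /H].
  by move=> [] H i iJ; have := H i; rewrite !inE iJ orbT => /(_ isT);
    case: eqP => // ik; move: kJ; rewrite -ik iJ.
- apply/seteqP; split => // u [/= /(_ k) + /(_ k)].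
  by rewrite !inE eqxx => /(_ isT) -> /(_ isT).
Qed.

Let coins (u : measurableTypeR R) : config :=
  fun i : int => digit (choice.pickle i) u.

Let measurable_coins : measurable_fun [set: measurableTypeR R] coins.
Proof. by apply: measurable_fun_config => i; exact: measurable_digit. Qed.

Let coins_law : set config -> \bar R := pushforward unif coins.

HB.instance Definition _ := Measure.copy coins_law
  (measure_function_pushforward__canonical__measure_function_Measure unif measurable_coins).

Let coins_lawT : coins_law [set: config] = 1%E.
Proof.
have := unif_digits fset0 xpredT; rewrite big_seq_fset0 => <-.
by congr (unif _); apply/seteqP; split.
Qed.

HB.instance Definition _ := Measure_isProbability.Build _ _ _ coins_law coins_lawT.

Lemma iid_coins_exist : exists Q : probability config R, iid_coins p Q.
Proof.
exists (coins_law : probability config R) => J a.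
pose b (n : nat) := if choice.unpickle n is Some i then a i else false.
have -> : \prod_(i <- J) bernoulli_pmf p (a i) =
    \prod_(n <- [fset choice.pickle i | i in J]%fset) bernoulli_pmf p (b n).
  rewrite big_imfset /=; last by move=> ? ? _ _; exact: (pcan_inj choice.pickleK).
  by apply: eq_bigr => i _; rewrite /b choice.pickleK.
rewrite -unif_digits; congr (unif _); apply/seteqP; split=> u /=.
  by move=> H _ /imfsetP[i /= iJ ->]; rewrite /b choice.pickleK -H.
move=> H i iJ; rewrite [LHS](H (choice.pickle i)) ?/b ?choice.pickleK//.
exact: in_imfset.
Qed.
End iid_coins_exist.

(* The law of a field (xi_i)_(i in Z) of i.i.d. Bernoulli(p) coins. *)
Definition coin_law (R : realType) (p : R) (p01 : 0 < p < 1) :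
  probability config R := sval (cid (iid_coins_exist p01)).

Lemma coin_lawP (R : realType) (p : R) (p01 : 0 < p < 1) :
  iid_coins p (coin_law p01).
Proof. exact: (svalP (cid (iid_coins_exist p01))). Qed.

(* A particle at i attempts to jump iff its coin shows [true]; the attempt
   succeeds iff the site i + 1 is empty before the step. *)
Definition jumps (eta xi : config) (i : int) : bool :=
  [&& eta i, ~~ eta (i + 1) & xi i].

Definition step (eta xi : config) : config :=
  fun i : int => (eta i && ~~ jumps eta xi i) || jumps eta xi (i - 1).

Lemma measurable_step :
  measurable_fun [set: config * config] (fun z : config * config => step z.1 z.2).
Proof.
have m1 (i : int) : measurable_fun [set: config * config]
    (fun z : config * config => z.1 i : bool).
  exact: (measurableT_comp (measurable_proj_config i) measurable_fst).
have m2 (i : int) : measurable_fun [set: config * config]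
    (fun z : config * config => z.2 i : bool).
  exact: (measurableT_comp (measurable_proj_config i) measurable_snd).
have mj i : measurable_fun [set: config * config]
    (fun z : config * config => jumps z.1 z.2 i).
  by do 2 apply: measurable_and => //; exact: measurable_neg.
apply: measurable_fun_config => i; apply: measurable_or => //.
by apply: measurable_and => //; exact: measurable_neg.
Qed.

Lemma measurable_step2 (eta : config) : measurable_fun [set: config] (step eta).
Proof. exact: (measurableT_comp measurable_step (pair1_measurable eta)). Qed.

HB.instance Definition _ (eta : config) :=
  isMeasurableFun.Build _ _ config config (step eta) (measurable_step2 eta).

Section tasep_kernel.
Variables (R : realType) (p : R) (p01 : 0 < p < 1).

(* [tasep_kernel eta] is the law of [step eta xi] for i.i.d. coins xi. *)
Definition tasep_kernel (eta : config) : {measure set config -> \bar R} :=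
  distribution (coin_law p01) (step eta).

Let measurable_tasep_kernel (U : set config) : measurable U ->
  measurable_fun [set: config] (tasep_kernel ^~ U).
Proof.
move=> mU.
pose B := (fun z : config * config => step z.1 z.2) @^-1` U.
have mB : measurable B.
  by rewrite -[X in measurable X]setTI; exact: measurable_step.
rewrite (_ : tasep_kernel ^~ U = coin_law p01 \o xsection B).
  exact: measurable_fun_xsection.
apply/funext => eta; rewrite /tasep_kernel /distribution /pushforward /=.
by congr (coin_law p01 _); apply/seteqP; split=> xi; rewrite /xsection/= inE.
Qed.

HB.instance Definition _ := isKernel.Build _ _ config config R
  tasep_kernel measurable_tasep_kernel.

Let tasep_kernelT (eta : config) : tasep_kernel eta [set: config] = 1%E.
Proof. exact: probability_setT. Qed.

HB.instance Definition _ := Kernel_isProbability.Build _ _ config config R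
  tasep_kernel tasep_kernelT.

End tasep_kernel.

(* If X_0 has law mu then X_1 has law mu. *)
Definition invariant_measure d (T : measurableType d) (R : realType)
    (K : R.-pker T ~> T) (mu : probability T R) : Prop :=
  forall A, measurable A -> (\int[mu]_eta K eta A)%E = mu A.

(* [x] lists the positions of the particles as ... < x_0 < x_1 < ... *)
Definition particle_positions (eta : config) (x : int -> int) : Prop :=
  {homo x : i j / i < j} /\ range x = [set i : int | eta i].

(* The limit does not depend on which particle carries the label 0. *)
Definition has_density (R : realType) (eta : config) (rho : R) : Prop :=
  exists2 x : int -> int, particle_positions eta x &
    (n%:R / (x (n%:Z - 1) - x 0)%:~R : R) @[n --> \oo] --> rho.

(* Main.v *)
From HB Require Import structures.
Require Import Defs.
From mathcomp Require Import all_boot all_order all_algebra finmap.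
From mathcomp Require Import ring lra zify.
From mathcomp Require Import all_classical all_reals all_analysis.
From mathcomp Require Import measurable_realfun.
Set Implicit Arguments.
Unset Strict Implicit.
Unset Printing Implicit Defensive.
Import Order.TTheory GRing.Theory Num.Theory.
Import numFieldNormedType.Exports.

Local Open Scope classical_set_scope.
Local Open Scope ring_scope.

(** The invariant measure of density [rho] is a stationary two-state Markov
    chain in space: going one site to the right, an occupied site is followed
    by an empty one with probability [al], an empty site by an occupied one
    with probability [be], where
<<
      rho al = (1 - rho) be      and      (1 - al) (1 - be) = (1 - p) al be.
>>
    The first equation makes [rho] the density.  The second one gives a word
    the weight  z^(number of particles) (1 - p)^(- number of words 10)  up to
    boundary terms.  Multiplying by the probability of the coins, a
    configuration together with its set of jumping bonds has weight
    z^(number of particles) (p / (1 - p))^(number of jumps): the line is tiled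
    by independent tiles, namely holes, particles at rest, and jumping pairs.
    A jumping pair reads 10 before the step and 01 after it, so the
    configuration after the step is the mirror image of a tiling with the law
    of the tiling before the step.  The chain is reversible in space, hence
    the law is invariant.

    This picture is made rigorous on finite windows ([chain_invariant]).
    Reading the new configuration from left to right, all that matters of the
    past is whether a particle jumps into the next site.  Conditionally on the
    new configuration so far, the probability of such a jump is 0 if the last
    new site is occupied and [be * p] if it is empty ([entrance_weightS]).
    This single-letter memory is what makes the new configuration a chain with
    the same transitions.

    The chain is built from independent coins, moving away from the origin in
    both directions ([chain_measureP]); by reversibility the two halves fit
    together.  All words have positive weight, so nonempty open sets have
    positive measure.  The correlations decay like a power of
    [1 - al - be], so the number of particles among n sites has variance of
    order n, and a strong law of large numbers holds along both half-lines
    ([slln_geometric_correlations]).  Since [rho > 0] both half-lines contain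
    infinitely many particles, which can thus be enumerated, and the strong
    law gives the density ([has_density_halves]). *)

(** * The transition probabilities *)
Section chain_parameters.
Variables (R : realType) (p rho : R).
Hypotheses (p01 : 0 < p < 1) (rho01 : 0 < rho < 1).

(** Both equations together say that [c = rho al = (1 - rho) be], the density
    of the pairs 10, is a root of [p c^2 - c + rho (1 - rho)].  The smaller
    root lies below [rho] and [1 - rho]: the value of the polynomial there is
    negative. *)
Lemma chain_parameters_exist : exists al be : R,
  [/\ 0 < al < 1, 0 < be < 1, rho * al = (1 - rho) * be &
      (1 - al) * (1 - be) = (1 - p) * al * be].
Proof.
have [p0 p1] := andP p01; have [r0 r1] := andP rho01.
pose D := 1 - 4 * p * rho * (1 - rho).
have D0 : 0 <= D.
  have -> : D = (1 - 2 * rho) ^+ 2 + 4 * ((1 - p) * rho * (1 - rho)).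
    by rewrite /D; ring.
  by rewrite addr_ge0 ?sqr_ge0// !mulr_ge0// ltW// subr_gt0.
pose s := Num.sqrt D.
have s0 : 0 <= s by exact: sqrtr_ge0.
have sE : s ^+ 2 = D by exact: sqr_sqrtr.
pose c := (1 - s) / (2 * p).
have pc : 2 * p * c = 1 - s by rewrite /c mulrC divfK// mulf_neq0// gt_eqF//; lra.
have cE : p * c ^+ 2 - c + rho * (1 - rho) = 0.
  have : 4 * p * (p * c ^+ 2 - c + rho * (1 - rho)) = 0.
    have -> : 4 * p * (p * c ^+ 2 - c + rho * (1 - rho)) =
      (2 * p * c) ^+ 2 - 2 * (2 * p * c) + 4 * p * rho * (1 - rho) by ring.
    by rewrite pc; move: sE; rewrite /D => sE; ring: sE.
  by move=> /eqP; rewrite mulf_eq0 => /orP[/eqP|/eqP//]; nra.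
have q0 : 0 < p * rho * (1 - rho).
  by rewrite mulr_gt0 ?subr_gt0// mulr_gt0.
have s1 : s < 1.
  by rewrite -(@ltr_pXn2r _ 2)// ?nnegrE ?ler01// sE expr1n /D; lra.
have c0 : 0 < c by rewrite divr_gt0 ?mulr_gt0 ?subr_gt0.
have key t : 0 < t -> p * t * t * (1 - p) > 0 -> D = 1 - 4 * p * t * (1 - t) ->
    c < t.
  move=> t0 tq DE; rewrite ltNge; apply/negP => tc.
  have : s <= 1 - 2 * p * t by nra.
  by nra.
have cr : c < rho by apply: key => //; rewrite !mulr_gt0 ?subr_gt0.
have cr' : c < 1 - rho.
  by apply: key; rewrite ?subr_gt0// ?mulr_gt0 ?subr_gt0// /D; ring.
have r'0 : 0 < 1 - rho by rewrite subr_gt0.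
exists (c / rho), (c / (1 - rho)); split.
- by rewrite divr_gt0//= ltr_pdivrMr// mul1r.
- by rewrite divr_gt0//= ltr_pdivrMr// mul1r.
- by rewrite !(mulrC _ (c / _)) !divfK ?gt_eqF.
- apply/eqP; rewrite -subr_eq0; apply/eqP.
  have -> : (1 - c / rho) * (1 - c / (1 - rho)) -
    (1 - p) * (c / rho) * (c / (1 - rho)) =
    (p * c ^+ 2 - c + rho * (1 - rho)) / (rho * (1 - rho)).
    by field; rewrite !gt_eqF.
  by rewrite cE mul0r.
Qed.
End chain_parameters.

(** * Positions of the particles and density *)
Definition occupation (b : nat -> bool) (n : nat) : nat := \sum_(i < n) b i.

Lemma occupationS b n : occupation b n.+1 = (occupation b n + b n)%N.
Proof. by rewrite /occupation big_ord_recr. Qed.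

Lemma occupation_homo b : {homo occupation b : m n / (m <= n)%N}.
Proof.
apply: homo_leq => [//|? ? ?|n]; first exact: leq_trans.
by rewrite occupationS leq_addr.
Qed.

(** The n-th particle is the particle with n particles before it. *)
Lemma occupation_enum (b : nat -> bool) :
  (forall n, exists m, (n < occupation b m)%N) ->
  exists x : nat -> nat, [/\ {homo x : m n / (m < n)%N}, range x = [set i | b i] &
    forall n, occupation b (x n) = n].
Proof.
move=> unb.
have /choice[x xP] : forall n, exists i, b i /\ occupation b i = n.
  move=> n; case: (ex_minnP (unb n)) => -[|i]; first by rewrite /occupation big_ord0.
  rewrite occupationS => ni imin; exists i.
  have : ~~ (n < occupation b i)%N by apply/negP => /imin; rewrite ltnn.
  by case: (b i) ni; lia.
have lt_occ i j : b i -> (i < j)%N -> (occupation b i < occupation b j)%N.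
  move=> bi ij; apply: leq_trans (occupation_homo b ij).
  by rewrite occupationS bi addn1.
exists x; split=> [m n mn||n]; last by case: (xP n).
- rewrite ltnNge; apply/negP => /(occupation_homo b).
  by case: (xP m) => _ ->; case: (xP n) => _ ->; lia.
- apply/seteqP; split=> [_ [n _ <-]|i /= bi]; first by case: (xP n).
  exists (occupation b i) => //; have [bx ox] := xP (occupation b i).
  case: (ltngtP (x (occupation b i)) i) => // h.
    by have := lt_occ _ _ bx h; rewrite ox ltnn.
  by have := lt_occ _ _ bi h; rewrite ox ltnn.
Qed.

Section density.
Variables (R : realType) (rho : R).

Let cvg_invn : ((n%:R)^-1 : R) @[n --> \oo] --> (0 : R).
Proof.
rewrite -(cvg_shiftS (fun m : nat => m%:R^-1 : R)) /=; exact: cvg_harmonic.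
Qed.

(** A bounded number of particles would have density 0. *)
Lemma cvg_unbounded_occupation (b : nat -> bool) : 0 < rho ->
  ((occupation b n)%:R / n%:R : R) @[n --> \oo] --> rho ->
  forall n, exists m, (n < occupation b m)%N.
Proof.
move=> rho0 bcvg n; apply: contrapT => /forallNP h.
suff r0 : rho = 0 by move: rho0; rewrite r0 ltxx.
apply: (cvg_unique _ bcvg) => //=.
apply: (@squeeze_cvgr _ _ _ _ (fun=> 0) (fun m => n%:R * m%:R^-1)).
- apply: nearW => m; rewrite divr_ge0//= ler_wpM2r ?invr_ge0// ler_nat.
  by rewrite leqNgt; apply/negP.
- exact: cvg_cst.
- rewrite -[X in _ --> X](mulr0 n%:R); apply: cvgMr; exact: cvg_invn.
Qed.

(** Label by 0 the first particle at a nonnegative site.  The n-th particle on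
    the right sits at a site [x n] with exactly n particles between 0 and
    [x n], so [n / x n] is a subsequence of the sequence of empirical
    densities.  The left half-line only has to supply the particles with
    negative labels. *)
Lemma has_density_halves (eta : config) : 0 < rho ->
  ((occupation (eta \o Posz) n)%:R / n%:R : R) @[n --> \oo] --> rho ->
  ((occupation (eta \o Negz) n)%:R / n%:R : R) @[n --> \oo] --> rho ->
  has_density eta rho.
Proof.
move=> rho0 cvgp cvgn.
have [x [xh xr xN]] := occupation_enum (cvg_unbounded_occupation rho0 cvgp).
have [y [yh yr yN]] := occupation_enum (cvg_unbounded_occupation rho0 cvgn).
pose z (i : int) : int := match i with Posz n => Posz (x n) | Negz n => Negz (y n) end.
exists z.
  split.
    move=> [m|m] [n|n]; rewrite /z ?NegzE /= => mn.
    - by rewrite ltz_nat; apply: xh.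
    - by move: mn; lia.
    - by lia.
    - by have := @yh n m; lia.
  apply/seteqP; split=> [_ [[n|n] _ <-]|[i|i] ei] /=.
  - have : range x (x n) by exists n.
    by rewrite xr.
  - have : range y (y n) by exists n.
    by rewrite yr.
  - have : [set i | (eta \o Posz) i] i by [].
    by rewrite -xr => -[n _ <-]; exists (Posz n).
  - have : [set i | (eta \o Negz) i] i by [].
    by rewrite -yr => -[n _ <-]; exists (Negz n).
have xge n : (n <= x n)%N.
  by elim: n => // n IH; apply: leq_ltn_trans IH (xh _ _ _).
have xoo : x n @[n --> \oo] --> \oo.
  apply/cvgnyPge => A; near=> n; apply: leq_trans (xge n).
  by near: n; exact: nbhs_infty_ge.
rewrite -(cvg_shiftS (fun n : nat => n%:R / (z (n%:Z - 1) - z 0)%:~R : R)) /=.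
have inv0 : ((x n)%:R^-1 : R) @[n --> \oo] --> 0.
  exact: (cvg_comp _ _ xoo cvg_invn).
have nx : (n%:R / (x n)%:R : R) @[n --> \oo] --> rho.
  rewrite (_ : (fun n => _) = (fun m => (occupation (eta \o Posz) m)%:R / m%:R) \o x).
    exact: (cvg_comp _ _ xoo).
  by apply/funext => n /=; rewrite xN.
have lim : ((n%:R / (x n)%:R + (x n)%:R^-1) * (1 - (x 0%N)%:R * (x n)%:R^-1)^-1 : R)
    @[n --> \oo] --> rho.
  rewrite (_ : rho = (rho + 0) * (1 - (x 0%N)%:R * 0)^-1); last first.
    by rewrite mulr0 subr0 invr1 mulr1 addr0.
  apply: cvgM; first exact: cvgD nx inv0.
  apply: cvgV; first by rewrite mulr0 subr0 oner_eq0.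
  by apply: cvgB; [exact: cvg_cst|apply: cvgMr; exact: inv0].
apply: cvg_trans lim; apply: near_eq_cvg; near=> n.
have n0 : (0 < n)%N by near: n; exact: nbhs_infty_gt.
rewrite subn1 /= rmorphB /= -!pmulrn.
have x0 : (x n)%:R != 0 :> R.
  by rewrite pnatr_eq0 -lt0n (leq_trans n0)// xge.
have x1 : (x n)%:R - (x 0%N)%:R != 0 :> R.
  by rewrite subr_eq0 eqr_nat gtn_eqF// xh.
rewrite -natr1; field; rewrite x0 x1 /=.
Unshelve. all: by end_near.
Qed.
End density.

(** * Laws determined by their windows *)
Lemma measure_split d (T : measurableType d) (R : realType)
    (m : {measure set T -> \bar R}) (f : T -> bool) (A : set T) :
  measurable_fun [set: T] f -> measurable A ->
  m A = (m (A `&` [set t | f t = true]) + m (A `&` [set t | f t = false]))%E.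
Proof.
move=> mf mA.
have mfb b : measurable [set t | f t = b].
  by rewrite -[X in measurable X]setTI; exact: (mf measurableT [set b]).
rewrite -measureU; [|exact: measurableI..|].
  rewrite -setIUr; congr (m _); apply/seteqP; split=> t; last by case.
  by move=> At; split=> //=; case: (f t); [left|right].
by apply/seteqP; split=> // t [[_ /= ->] []].
Qed.

(** The word is carried by a whole configuration [w], of which only the sites
    of the window matter: windows that grow or overlap then share one word and
    need no reindexing. *)
Definition window (a : int) (n : nat) (w : config) : set config :=
  [set eta | forall k : nat, (k < n)%N -> eta (a + k%:Z) = w (a + k%:Z)].

Definition update (w : config) (i : int) (b : bool) : config :=
  fun j => if j == i then b else w j.

Lemma updateE w i b : update w i b i = b.
Proof. by rewrite /update eqxx. Qed.

Lemma update_neq w i b j : j != i -> update w i b j = w j.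
Proof. by rewrite /update => /negbTE ->. Qed.

Lemma measurable_occupied (i : int) (b : bool) :
  measurable [set eta : config | eta i = b].
Proof.
rewrite -[X in measurable X]setTI.
by have := measurable_proj_config i measurableT (I : measurable [set b]).
Qed.

Lemma windowS a n w :
  window a n.+1 w = window a n w `&` [set eta | eta (a + n%:Z) = w (a + n%:Z)].
Proof.
apply/seteqP; split=> eta /=; first by move=> H; split=> [k kn|]; apply: H; lia.
by move=> [H Hn] k; rewrite ltnS leq_eqVlt => /predU1P[->//|/H].
Qed.

Lemma windowSl a n w :
  window a n.+1 w = [set eta | eta a = w a] `&` window (a + 1) n w.
Proof.
apply/seteqP; split=> eta /=.
  move=> H; split=> [|k kn]; first by have := H 0%N; rewrite addr0; exact.
  by have := H k.+1; rewrite -addrA -intS; apply.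
move=> [H0 H] [|k] kn; first by rewrite addr0.
by rewrite intS addrA; apply: H.
Qed.

Lemma measurable_window a n w : measurable (window a n w).
Proof.
elim: n => [|n IH]; last first.
  by rewrite windowS; apply: measurableI => //; exact: measurable_occupied.
by rewrite (_ : window _ _ _ = setT)//; apply/seteqP; split.
Qed.

Lemma window0 a w : window a 0 w = setT.
Proof. by apply/seteqP; split. Qed.

Lemma eq_window a n w w' :
  (forall k : nat, (k < n)%N -> w (a + k%:Z) = w' (a + k%:Z)) ->
  window a n w = window a n w'.
Proof. by move=> ww'; apply/seteqP; split=> eta H k kn; rewrite H// ww'. Qed.

Lemma window_update a n w b :
  window a n w `&` [set eta | eta (a + n%:Z) = b] =
  window a n.+1 (update w (a + n%:Z) b).
Proof.
rewrite windowS updateE; congr (_ `&` _); apply: eq_window => k kn.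
by rewrite update_neq//; lia.
Qed.

Lemma window_update_left a n w b :
  [set eta | eta a = b] `&` window (a + 1) n w = window a n.+1 (update w a b).
Proof.
rewrite windowSl updateE; congr (_ `&` _); apply: eq_window => k kn.
by rewrite update_neq//; lia.
Qed.

Lemma measurable_cylinder s : measurable (cylinder s).
Proof.
elim: s => [|[i b] s IH].
  by rewrite (_ : cylinder _ = setT)//; apply/seteqP; split.
rewrite (_ : cylinder _ = [set eta | eta i = b] `&` cylinder s).
  by apply: measurableI => //; exact: measurable_occupied.
apply/seteqP; split=> eta; rewrite /cylinder /=; first by move=> /andP[/eqP].
by move=> [-> ->]; rewrite eqxx.
Qed.

Lemma sites_in_window (s : seq (int * bool)) : exists N : nat,
  forall q, q \in s -> exists2 k : nat, (k < N.*2)%N & q.1 = - N%:Z + k%:Z.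
Proof.
exists (\max_(q <- s) `|q.1|%N).+1 => q qs.
have : (`|q.1| <= \max_(q <- s) `|q.1|%N)%N by rewrite (big_rem q)//= leq_maxl.
set N := (\max_(q <- s) _)%N => qN.
by exists (absz (q.1 + N.+1%:Z)); lia.
Qed.

(** Cylinders form a generating pi-system.  The measure of a cylinder is
    obtained from windows by deciding the undecided sites of a window around
    its support one after the other. *)
Lemma eq_measure_windows (R : realType) (m1 m2 : probability config R) :
  (forall a n w, m1 (window a n.+1 w) = m2 (window a n.+1 w)) ->
  forall A, measurable A -> m1 A = m2 A.
Proof.
move=> m12 A mA.
have {}m12 a n w : m1 (window a n w) = m2 (window a n w).
  by case: n => // ; rewrite window0 !probability_setT.
pose G : set (set config) := [set B | exists s, B = cylinder s].
have Gcyl s : G (cylinder s) by exists s.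
have nilT : cylinder [::] = setT by apply/seteqP; split.
apply: (measure_unique G (fun=> setT)) => //.
- apply/seteqP; split; last first.
    apply: smallest_sub; first exact: sigma_algebra_measurable.
    by move=> _ [s ->]; exact: measurable_cylinder.
  move=> B mB.
  suff : measurable_fun [set: g_sigma_algebraType G] (fun x => x : config).
    by move=> /(_ measurableT _ mB); rewrite setTI preimage_id.
  apply: measurable_fun_config => i; apply: (measurable_fun_bool true).
  rewrite setTI; apply: sub_sigma_algebra; exists [:: (i, true)].
  by apply/seteqP; split=> x; rewrite /cylinder /= andbT => /eqP.
- move=> _ _ [s ->] [s' ->]; exists (s ++ s').
  by apply/seteqP; split=> x; rewrite /cylinder /= all_cat => /andP.
- by move=> _; rewrite -nilT.
- by apply/seteqP; split=> // x _; exists 0%N.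
- move=> _ [s ->]; have [N sN] := sites_in_window s.
  suff H j k w : (k + j)%N = N.*2 ->
      m1 (window (- N%:Z) k w `&` cylinder s) = m2 (window (- N%:Z) k w `&` cylinder s).
    by have := H N.*2 0%N (fun=> true) (add0n _); rewrite window0 setTI.
  elim: j k w => [|j IH] k w kj.
    (* All sites are decided, so the window lies inside the cylinder or misses it. *)
    have -> : window (- N%:Z) k w `&` cylinder s =
        if all (fun q => w q.1 == q.2) s then window (- N%:Z) k w else set0.
      have ws eta : window (- N%:Z) k w eta ->
          all (fun q => eta q.1 == q.2) s = all (fun q => w q.1 == q.2) s.
        move=> H; apply: eq_in_all => q /sN[i iN ->]; rewrite H//; lia.
      case: ifP => ws'; apply/seteqP; split=> eta.
      - by case.
      - by move=> H; split=> //; rewrite /cylinder /= ws.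
      - by move=> [/ws Hw]; rewrite /cylinder /= Hw ws'.
      - by [].
    by case: ifP => // _; rewrite !measure0.
  have mW : measurable (window (- N%:Z) k w `&` cylinder s).
    by apply: measurableI; [exact: measurable_window|exact: measurable_cylinder].
  have mf := @measurable_proj_config (- N%:Z + k%:Z).
  rewrite (measure_split m1 mf mW) (measure_split m2 mf mW).
  rewrite !(setIAC (window _ _ _) (cylinder s)) !window_update.
  by congr (_ + _)%E; apply: IH; lia.
- by move=> _; have := probability_setT m1; rewrite /= => ->; rewrite ltry.
Qed.

(** * Stationary two-state chains *)
Section chain_law.
Variables (R : realType) (rho al be : R).

Definition transition (x y : bool) : R := bernoulli_pmf (if x then 1 - al else be) y.

(** [n] counts the transitions, so that [n.+1] letters are weighed. *)
Definition chain_weight (a : int) (n : nat) (w : config) : R :=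
  bernoulli_pmf rho (w a) *
  \prod_(k < n) transition (w (a + k%:Z)) (w (a + k.+1%:Z)).

Definition chain_law (mu : probability config R) : Prop :=
  forall a n w, mu (window a n.+1 w) = (chain_weight a n w)%:E.

Lemma transition1 x : transition x true + transition x false = 1.
Proof. by rewrite /transition /bernoulli_pmf addrC subrK. Qed.

Lemma transition1_scale x c : c * transition x true + c * transition x false = c.
Proof. by rewrite -mulrDr transition1 mulr1. Qed.

Lemma eq_chain_weight a n w w' :
  (forall k : nat, (k <= n)%N -> w (a + k%:Z) = w' (a + k%:Z)) ->
  chain_weight a n w = chain_weight a n w'.
Proof.
move=> ww'; rewrite /chain_weight; congr (_ * _).
  by have := ww' 0%N isT; rewrite addr0 => ->.
by apply: eq_bigr => k _; rewrite !ww'// ltnW.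
Qed.

Lemma chain_weight0 a w : chain_weight a 0 w = bernoulli_pmf rho (w a).
Proof. by rewrite /chain_weight big_ord0 mulr1. Qed.

Lemma chain_weightS a n w : chain_weight a n.+1 w =
  chain_weight a n w * transition (w (a + n%:Z)) (w (a + n.+1%:Z)).
Proof. by rewrite /chain_weight big_ord_recr /= mulrA. Qed.

Lemma chain_weight_update a n w b : chain_weight a n.+1 (update w (a + n.+1%:Z) b) =
  chain_weight a n w * transition (w (a + n%:Z)) b.
Proof.
rewrite chain_weightS updateE update_neq; last by lia.
congr (_ * _); apply: eq_chain_weight => k kn; rewrite update_neq//; lia.
Qed.

Hypothesis balance : rho * al = (1 - rho) * be.

(** Detailed balance, which for two states is stationarity itself. *)
Lemma transition_reversible x y :
  bernoulli_pmf rho x * transition x y = bernoulli_pmf rho y * transition y x.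
Proof.
by case: x; case: y; rewrite /transition /bernoulli_pmf //= ?subKr ?balance.
Qed.

(** By reversibility a chain may also be grown to the left, with the same
    transition probabilities. *)
Lemma chain_weightSl a n w : chain_weight a n.+1 w =
  transition (w (a + 1)) (w a) * chain_weight (a + 1) n w.
Proof.
rewrite /chain_weight big_ord_recl /= addr0 mulrA transition_reversible.
rewrite -mulrA mulrCA; congr (_ * (_ * _)).
apply: eq_bigr => k _; rewrite /bump /= add1n (intS k) (intS k.+1) !addrA.
by congr transition; congr w; lia.
Qed.

Lemma chain_law_drop_right (mu : probability config R) a n :
  (forall w, mu (window a n.+2 w) = (chain_weight a n.+1 w)%:E) ->
  forall w, mu (window a n.+1 w) = (chain_weight a n w)%:E.
Proof.
move=> H w.
rewrite (measure_split mu (measurable_proj_config (a + n.+1%:Z))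
  (measurable_window a n.+1 w)).
rewrite !window_update [X in (X + _)%E]H [X in (_ + X)%E]H -EFinD.
apply: (congr1 EFin); rewrite !chain_weight_update.
by rewrite (transition1_scale _ (chain_weight a n w)).
Qed.

Lemma chain_law_drop_left (mu : probability config R) a n :
  (forall w, mu (window a n.+2 w) = (chain_weight a n.+1 w)%:E) ->
  forall w, mu (window (a + 1) n.+1 w) = (chain_weight (a + 1) n w)%:E.
Proof.
move=> H w.
rewrite (measure_split mu (measurable_proj_config a)
  (measurable_window (a + 1) n.+1 w)).
rewrite !(setIC (window _ _ _)) !window_update_left.
rewrite [X in (X + _)%E]H [X in (_ + X)%E]H -EFinD.
apply: (congr1 EFin).
rewrite !chain_weightSl !updateE !update_neq; [|by lia..].
have E b : chain_weight (a + 1) n (update w a b) = chain_weight (a + 1) n w.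
  by apply: eq_chain_weight => k _; rewrite update_neq//; lia.
by rewrite !E ![_ * chain_weight _ _ _]mulrC transition1_scale.
Qed.

(** Windows that contain the origin suffice: any window is reached from a large
    symmetric one by dropping sites at its ends. *)
Lemma chain_law_windows (mu : probability config R) :
  (forall m n w, mu (window (- m%:Z) (m + n).+1 w) =
    (chain_weight (- m%:Z) (m + n) w)%:E) ->
  chain_law mu.
Proof.
move=> H a n; pose M := (absz a + n)%N.
have right k : (k <= M + M)%N ->
    forall w, mu (window (- M%:Z) (M + M - k).+1 w) =
      (chain_weight (- M%:Z) (M + M - k) w)%:E.
  elim: k => [|k IH] kM; first by rewrite subn0; exact: H.
  apply: chain_law_drop_right.
  by have -> : (M + M - k.+1).+1 = (M + M - k)%N; [lia|apply: IH; lia].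
suff left j b :
    (forall w, mu (window b (n + j).+1 w) = (chain_weight b (n + j) w)%:E) ->
    forall w, mu (window (b + j%:Z) n.+1 w) = (chain_weight (b + j%:Z) n w)%:E.
  have -> : a = - M%:Z + (absz (a + M%:Z))%:Z by lia.
  apply: left.
  have -> : (n + absz (a + M%:Z)%R =
      M + M - (M + M - (n + absz (a + M%:Z)%R)))%N by lia.
  by apply: right; lia.
elim: j b => [|j IH] b; first by rewrite addn0 addr0.
rewrite addnS => /chain_law_drop_left /IH.
by have -> : b + 1 + j%:Z = b + j.+1%:Z by lia.
Qed.
End chain_law.

(** * Construction of the chain *)
Section chain_construction.
Variables (R : realType) (rho al be : R).
Hypotheses (rho01 : 0 < rho < 1) (al01 : 0 < al < 1) (be01 : 0 < be < 1).
Hypothesis balance : rho * al = (1 - rho) * be.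

Let al'01 : 0 < 1 - al < 1.
Proof. by case/andP: al01 => ? ?; rewrite subr_gt0 gtrBl; apply/andP. Qed.

Let coins3 : probability (config * config * config)%type R :=
  ((coin_law rho01 \x coin_law al'01) \x coin_law be01)%E.

(** Each site carries two coins, one for each possible letter of the preceding
    site in the direction away from the origin.  The coins [t.1.1] are used at
    the origin only, [t.1.2] next to an occupied site, [t.2] next to an empty
    one. *)
Fixpoint chain_right (t : config * config * config) (n : nat) : bool :=
  if n is m.+1 then
    if chain_right t m then t.1.2 m.+1%:Z else t.2 m.+1%:Z
  else t.1.1 0.

Fixpoint chain_left (t : config * config * config) (n : nat) : bool :=
  if n is m.+1 then
    if chain_left t m then t.1.2 (- m.+1%:Z) else t.2 (- m.+1%:Z)
  else t.1.1 0.

Definition chain (t : config * config * config) : config :=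
  fun i => match i with Posz n => chain_right t n | Negz n => chain_left t n.+1 end.

Lemma measurable_chain : measurable_fun [set: config * config * config] chain.
Proof.
have m0 i : measurable_fun [set: config * config * config] (fun t => t.1.1 i : bool).
  exact: (measurableT_comp (measurable_proj_config i)
    (measurableT_comp measurable_fst measurable_fst)).
have m1 i : measurable_fun [set: config * config * config] (fun t => t.1.2 i : bool).
  exact: (measurableT_comp (measurable_proj_config i)
    (measurableT_comp measurable_snd measurable_fst)).
have m2 i : measurable_fun [set: config * config * config] (fun t => t.2 i : bool).
  exact: (measurableT_comp (measurable_proj_config i) measurable_snd).
apply: measurable_fun_config => -[n|n].
- by elim: n => [|n IH] //=; exact: measurable_fun_ifT.
- rewrite /chain; elim: n.+1 => [|{}n IH] //=; exact: measurable_fun_ifT.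
Qed.

HB.instance Definition _ := isMeasurableFun.Build _ _ _ _ chain measurable_chain.

(** The neighbour of i on the side of the origin. *)
Let prev (i : int) : int := match i with Posz n => n.-1%:Z | Negz n => - n%:Z end.

Let sites (m n : nat) : seq int :=
  [seq - k.+1%:Z | k <- iota 0 m] ++ [seq k.+1%:Z | k <- iota 0 n].

Let mem_sites m n i : (i \in sites m n) = (i != 0) && (- m%:Z <= i <= n%:Z).
Proof.
rewrite mem_cat; apply/orP/idP => [[] /mapP[k]|].
- by rewrite mem_iota => km ->; lia.
- by rewrite mem_iota => km ->; lia.
- case: i => [[|i]|i] // h; [right|left].
    by apply/mapP; exists i => //; rewrite mem_iota; lia.
  by apply/mapP; exists i; rewrite ?mem_iota; lia.
Qed.

Let uniq_sites m n : uniq (sites m n).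
Proof.
rewrite cat_uniq; apply/and3P; split.
- by rewrite map_inj_uniq ?iota_uniq// => i j; lia.
- by apply/hasPn => _ /mapP[k _ ->]; apply/mapP => -[l _]; lia.
- by rewrite map_inj_uniq ?iota_uniq// => i j; lia.
Qed.

(** A word determines which coin each site looks at, so a window is a product
   of cylinders in the three coin fields. *)
Let chain_window m n (w : config) t : window (- m%:Z) (m + n).+1 w (chain t) <->
  t.1.1 0 = w 0 /\ forall i, i \in sites m n ->
    (if w (prev i) then t.1.2 i else t.2 i) = w i.
Proof.
have winP (eta : config) : window (- m%:Z) (m + n).+1 w eta <->
    (forall k : nat, (k <= n)%N -> eta k%:Z = w k%:Z) /\
    (forall k : nat, (k <= m)%N -> eta (- k%:Z) = w (- k%:Z)).
  split=> [H|[Hr Hl] k].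
    split=> k kn.
      by rewrite (_ : k%:Z = - m%:Z + (m + k)%:Z); [apply: H; lia|lia].
    by rewrite (_ : - k%:Z = - m%:Z + (m - k)%:Z); [apply: H; lia|lia].
  case: (leqP m k) => mk kn.
    by rewrite (_ : - m%:Z + k%:Z = (k - m)%:Z); [apply: Hr; lia|lia].
  by rewrite (_ : - m%:Z + k%:Z = - (m - k)%:Z); [apply: Hl; lia|lia].
have chainl k : chain t (- k%:Z) = chain_left t k by case: k => [|k] //.
rewrite winP; split=> [[Hr Hl]|[H0 H]].
  split=> [|i]; first by have := Hr 0%N isT.
  rewrite mem_sites; case: i => [[|i]|i] //= h.
    by rewrite -[in RHS]Hr; [rewrite -(Hr i) //; lia|lia].
  have E : chain_left t i.+1 = w (- i.+1%:Z) by rewrite -chainl; apply: Hl; lia.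
  have E' : chain_left t i = w (- i%:Z) by rewrite -chainl; apply: Hl; lia.
  by rewrite -E' NegzE -E.
split=> k kn.
  elim: k kn => [|k IH] kn //=.
  have := H k.+1%:Z; rewrite mem_sites /= => <-; last by lia.
  by move: IH => /= ->//; lia.
rewrite chainl; elim: k kn => [|k IH] kn //=.
have := H (- k.+1%:Z); rewrite mem_sites /= => <-; last by lia.
by rewrite IH//; lia.
Qed.

Let prod_sites m n (w : config) :
  bernoulli_pmf rho (w 0) * \prod_(i <- sites m n) transition al be (w (prev i)) (w i) =
  chain_weight rho al be (- m%:Z) (m + n) w.
Proof.
rewrite big_cat /= !big_map.
elim: m => [|m IH].
  rewrite big_nil mul1r oppr0 /chain_weight add0n.
  rewrite -(big_mkord xpredT (fun k : nat =>
    transition al be (w (0 + k%:Z)) (w (0 + k.+1%:Z)))) /index_iota subn0.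
  by congr (_ * _); apply: eq_bigr => k _; rewrite !add0r.
rewrite -addn1 iotaD big_cat big_seq1 /= add0n addn1 addSn chain_weightSl//.
have -> : - m.+1%:Z + 1 = - m%:Z by lia.
by rewrite -IH mulrAC -!mulrA [RHS]mulrC -!mulrA.
Qed.

Definition chain_measure : probability config R := distribution coins3 chain.

Lemma chain_measureP : chain_law rho al be chain_measure.
Proof.
apply: (chain_law_windows balance) => m n w.
rewrite -prod_sites.
pose J (b : bool) : {fset int} := [fset i in sites m n | w (prev i) == b]%fset.
pose E b := [set xi : config | forall i, i \in J b -> xi i = w i].
have mE b : measurable (E b).
  rewrite (_ : E b = \bigcap_(i in [set i | i \in J b]) [set xi : config | xi i = w i]).
    apply: fin_bigcap_measurable => [|i _]; first exact: finite_fset.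
    exact: measurable_occupied.
  by apply/seteqP; split.
have mE0 := measurable_occupied 0 (w 0).
rewrite /chain_measure /distribution /pushforward /=.
rewrite (_ : _ @^-1` _ = ([set xi : config | xi 0 = w 0] `*` E true) `*` E false).
  have coins3E (A : set (config * config)) (B : set config) :
      measurable A -> measurable B -> coins3 (A `*` B) =
      ((coin_law rho01 \x coin_law al'01) A * coin_law be01 B)%E.
    exact: product_measure1E.
  rewrite coins3E ?product_measure1E//; last exact: measurableX.
  have := coin_lawP rho01 [fset 0%R]%fset w; rewrite big_seq_fset1 => H0.
  have start : coin_law rho01 [set xi | xi 0 = w 0] = (bernoulli_pmf rho (w 0))%:E.
    rewrite -H0; congr (coin_law _ _); apply/seteqP; split=> xi /=.
      by move=> xi0 i; rewrite inE => /eqP ->.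
    by apply; rewrite inE.
  rewrite [X in (X * _ * _)%E]start [X in (_ * X * _)%E]coin_lawP.
  rewrite [X in (_ * X)%E]coin_lawP -!EFinM.
  apply: (congr1 EFin); rewrite -mulrA; congr (_ * _).
  have prodJ b : \prod_(i <- J b) bernoulli_pmf (if b then 1 - al else be) (w i) =
      \prod_(i <- sites m n | w (prev i) == b) transition al be (w (prev i)) (w i).
    rewrite -[RHS]big_filter [RHS](perm_big (J b)) /=; last first.
      apply: uniq_perm; [by rewrite filter_uniq|exact: fset_uniq|].
      by move=> i; rewrite mem_filter !inE andbC.
    by apply: eq_big_seq => i; rewrite !inE /transition => /andP[_ /eqP ->].
  rewrite (prodJ true) (prodJ false) [RHS](bigID (fun i => w (prev i))) /=.
  by congr (_ * _); apply: eq_bigl => i; case: (w (prev i)).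
apply/seteqP; split=> [t /chain_window [t0 H]|t [[/= t0 H1] H0]].
  split; [split=> // i|move=> i]; rewrite !inE => /andP[/H + /eqP wi];
    by rewrite wi.
apply/chain_window; split=> // i iS; case: ifP => wi.
  by apply: H1; rewrite !inE iS wi.
by apply: H0; rewrite !inE iS wi.
Qed.
End chain_construction.

(** * Invariance under the step *)
Definition step_pair (z : config * config) : config := step z.1 z.2.

HB.instance Definition _ := isMeasurableFun.Build _ _ (config * config)%type config
  step_pair measurable_step.

Section invariance.
Variables (R : realType) (p : R) (p01 : 0 < p < 1) (rho al be : R).
Hypotheses (balance : rho * al = (1 - rho) * be)
  (key : (1 - al) * (1 - be) = (1 - p) * al * be).
Variables (mu : probability config R) (muP : chain_law rho al be mu).

Local Notation trans := (transition al be).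
Local Notation coin := (bernoulli_pmf p).

Lemma coin_law_window a n (v : config) :
  coin_law p01 (window a n v) = (\prod_(k < n) coin (v (a + k%:Z)))%:E.
Proof.
pose J : {fset int} := [fset (a + k%:Z)%R | k in iota 0 n]%fset.
have -> : window a n v = [set xi : config | forall i, i \in J -> xi i = v i].
  apply/seteqP; split=> xi H.
    by move=> i /imfsetP[k /=]; rewrite mem_iota => /= kn ->; apply: H.
  by move=> k kn; apply: H; apply/imfsetP; exists k => //=; rewrite mem_iota.
rewrite coin_lawP; apply: (congr1 EFin).
rewrite big_imfset /=; last by move=> i j _ _ /addrI [].
rewrite undup_id ?iota_uniq//.
by rewrite -(big_mkord xpredT (fun k : nat => coin (v (a + k%:Z)))) /index_iota subn0.
Qed.

Let joint : probability (config * config)%type R := (mu \x coin_law p01)%E.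

Definition step_window (a : int) (n : nat) (w : config) : set (config * config) :=
  [set z | window a n w (step z.1 z.2)].

(** The conditional probability that the [n] sites from [a] on read [w] after
    the step, given whether a particle jumps into the site [a] ([j]) and
    whether [a] was occupied before the step ([u]).  The recursion draws the
    coin [x] of the site [a] and the old letter [v] of the site [a + 1]. *)
Fixpoint step_weight (n : nat) (a : int) (j u : bool) (w : config) : R :=
  if n is m.+1 then
    \sum_(x : bool) \sum_(v : bool) coin x * trans u v *
      ((u && ~~ [&& u, ~~ v & x] || j) == w a)%:R *
      step_weight m (a + 1) [&& u, ~~ v & x] v w
  else 1.

Let measurable_eta i :
  measurable_fun [set: config * config] (fun z : config * config => z.1 i : bool).
Proof. exact: (measurableT_comp (measurable_proj_config i) measurable_fst). Qed.

Let measurable_xi i :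
  measurable_fun [set: config * config] (fun z : config * config => z.2 i : bool).
Proof. exact: (measurableT_comp (measurable_proj_config i) measurable_snd). Qed.

Lemma measurable_step_window a n w : measurable (step_window a n w).
Proof.
rewrite -[X in measurable X]setTI; apply: measurable_step => //.
exact: measurable_window.
Qed.

Let split4 (A : set (config * config)) i j : measurable A ->
  joint A =
  (joint (A `&` [set z | z.1 i = true] `&` [set z | z.2 j = true]) +
   joint (A `&` [set z | z.1 i = true] `&` [set z | z.2 j = false]) +
   (joint (A `&` [set z | z.1 i = false] `&` [set z | z.2 j = true]) +
    joint (A `&` [set z | z.1 i = false] `&` [set z | z.2 j = false])))%E.
Proof.
move=> mA.
have mI b : measurable (A `&` [set z | z.1 i = b]).
  apply: measurableI => //; rewrite -[X in measurable X]setTI.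
  exact: (measurable_eta i measurableT (I : measurable [set b])).
rewrite (measure_split joint (measurable_eta i) mA).
by congr (_ + _)%E; exact: (measure_split joint (measurable_xi j) (mI _)).
Qed.

Let rect_update a n m (w v : config) (x y : bool) (S : set (config * config)) :
  (window a n w `*` window a m v) `&` S `&`
    [set z | z.1 (a + n%:Z) = x] `&` [set z | z.2 (a + m%:Z) = y] =
  (window a n.+1 (update w (a + n%:Z) x) `*`
   window a m.+1 (update v (a + m%:Z) y)) `&` S.
Proof.
rewrite -!window_update; apply/seteqP; split=> z /=; tauto.
Qed.

Let step_windowS a n w : step_window a n.+1 w =
  [set z | step z.1 z.2 a = w a] `&` step_window (a + 1) n w.
Proof. by rewrite /step_window windowSl. Qed.

(** The old letters up to the site [a + n + 1] and the coins up to [a + n]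
    influence the later sites through the last letter and the last jump
    only. *)
Lemma joint_step_window m a n (eta xi w : config) :
  joint ((window a n.+2 eta `*` window a n.+1 xi) `&` step_window (a + n.+1%:Z) m w) =
  (chain_weight rho al be a n.+1 eta * (\prod_(k < n.+1) coin (xi (a + k%:Z))) *
   step_weight m (a + n.+1%:Z) (jumps eta xi (a + n%:Z)) (eta (a + n.+1%:Z)) w)%:E.
Proof.
elim: m n eta xi => [|m IH] n eta xi.
  rewrite /step_window /= mulr1.
  rewrite (_ : _ `&` _ = window a n.+2 eta `*` window a n.+1 xi); last first.
    by apply/seteqP; split=> z; [case|split=> //; rewrite /= window0].
  rewrite EFinM -(muP a n.+1 eta) -(coin_law_window a n.+1 xi).
  exact: product_measure1E (measurable_window _ _ _) (measurable_window _ _ _).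
have an : a + n%:Z + 1 = a + n.+1%:Z by lia.
have an1 : a + n.+1%:Z + 1 = a + n.+2%:Z by lia.
have n1n2 : a + n.+1%:Z != a + n.+2%:Z by lia.
have nn1 : a + n%:Z != a + n.+1%:Z by lia.
have n3 : (n < n.+3)%N by lia.
have n13 : (n.+1 < n.+3)%N by lia.
have n2 : (n < n.+2)%N by lia.
have kn1 (k : 'I_n.+1) : a + k%:Z != a + n.+1%:Z by have := ltn_ord k; lia.
set i := a + n.+1%:Z.
rewrite (split4 (a + n.+2%:Z) i); last first.
  apply: measurableI; last exact: measurable_step_window.
  by apply: measurableX; exact: measurable_window.
rewrite !rect_update.
(* The contribution of one choice of the next letter and the next coin. *)
have piece v x : joint ((window a n.+3 (update eta (a + n.+2%:Z) v) `*`
      window a n.+2 (update xi i x)) `&` step_window i m.+1 w) =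
    (chain_weight rho al be a n.+1 eta * (\prod_(k < n.+1) coin (xi (a + k%:Z))) *
     (coin x * trans (eta i) v *
      ((eta i && ~~ [&& eta i, ~~ v & x] || jumps eta xi (a + n%:Z)) == w i)%:R *
      step_weight m (i + 1) [&& eta i, ~~ v & x] v w))%:E.
  set eta' := update eta _ v; set xi' := update xi i x.
  have ai : a + n.+2%:Z = i + 1 by [].
  have jE : jumps eta' xi' i = [&& eta i, ~~ v & x].
    by rewrite /jumps /eta' /xi' -ai !updateE update_neq.
  have jE' : jumps eta' xi' (a + n%:Z) = jumps eta xi (a + n%:Z).
    by rewrite /jumps /eta' /xi' an !update_neq// lt_eqF// ltrD2l ltz_nat ltnW.
  have stepE z : (window a n.+3 eta' `*` window a n.+2 xi') z ->
      step z.1 z.2 i = (eta i && ~~ [&& eta i, ~~ v & x] || jumps eta xi (a + n%:Z)).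
    move=> [/= H1 H2].
    have E1 k : (k < n.+3)%N -> z.1 (a + k%:Z) = eta' (a + k%:Z) by exact: H1.
    have E2 k : (k < n.+2)%N -> z.2 (a + k%:Z) = xi' (a + k%:Z) by exact: H2.
    have ei : eta' i = eta i by rewrite /eta' update_neq.
    have J1 : jumps z.1 z.2 i = jumps eta' xi' i.
      by rewrite /jumps -ai /i !E1// E2.
    have J0 : jumps z.1 z.2 (i - 1) = jumps eta' xi' (a + n%:Z).
      by rewrite /i -an addrK /jumps an !E1// E2.
    rewrite /step J1 J0 jE jE' -ei; congr ((_ && _) || _).
    by rewrite /i E1.
  rewrite step_windowS setIA.
  case: eqP => wi; last first.
    rewrite mulr0 mul0r mulr0.
    rewrite (_ : _ `&` _ = set0) ?measure0//; apply/seteqP; split=> // z [[zr /= zi] _].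
    by apply: wi; rewrite -zi stepE.
  rewrite (_ : _ `&` [set z | _] = window a n.+3 eta' `*` window a n.+2 xi'); last first.
    apply/seteqP; split=> z; first by case.
    by move=> zr; split=> //=; rewrite stepE.
  rewrite -ai IH; apply: (congr1 EFin).
  rewrite /eta' chain_weight_update big_ord_recr /= -/i -/eta' -/xi' jE.
  rewrite /eta' updateE {2}/xi' updateE.
  rewrite (eq_bigr (fun k : 'I_n.+1 => coin (xi (a + k%:Z)))); last first.
    by move=> k _; rewrite /xi' update_neq.
  by rewrite mulr1; ring.
rewrite !piece -!EFinD; apply: (congr1 EFin).
by rewrite /= !big_bool /=; ring.
Qed.

(** The probability that the [n] sites from [a] on read [w] after the step,
    given the new letters up to the site [a - 1], of which the last one is
    [x].  If [x] is a particle then no particle jumps into [a]; if [x] is a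
    hole then one does with probability [be * p]; and if none does, the site
    [a] was occupied with probability [be] whatever the past was. *)
Definition entrance_weight (x : bool) (n : nat) (a : int) (w : config) : R :=
  let free :=
    be * step_weight n a false true w + (1 - be) * step_weight n a false false w in
  if x then free else be * p * step_weight n a true false w + (1 - be * p) * free.

Let rel : p * al * be = al + be - 1.
Proof.
have -> : p * al * be = al + be - 1 + ((1 - al) * (1 - be) - (1 - p) * al * be) by ring.
by rewrite key subrr addr0.
Qed.

Let bal : rho * be = be - rho * al.
Proof. by rewrite balance; ring. Qed.

(** The key computation: the conditional law of the entering jump, given the
    new letters, depends on the last of them only, and the letters themselves
    follow the transitions of the chain.  The relation between [p], [al] and
    [be] is what makes the two sides agree. *)
Lemma entrance_weightS x n a w : entrance_weight x n.+1 a w =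
  trans x (w a) * entrance_weight (w a) n (a + 1) w.
Proof.
rewrite /entrance_weight /= !big_bool /=.
set s01 := step_weight n (a + 1) false true w.
set s00 := step_weight n (a + 1) false false w.
set s10 := step_weight n (a + 1) true false w.
by case: x; case: (w a); rewrite /transition /bernoulli_pmf /=; ring: rel.
Qed.

Lemma entrance_weightE n a w : entrance_weight (w a) n (a + 1) w =
  \prod_(k < n) trans (w (a + k%:Z)) (w (a + k.+1%:Z)).
Proof.
elim: n a => [|n IH] a.
  by rewrite big_ord0 /entrance_weight /=; case: (w a) => /=; ring.
rewrite entrance_weightS IH big_ord_recl /= addr0; congr (_ * _).
apply: eq_bigr => k _; rewrite /bump /= add1n (intS k) (intS k.+1) !addrA.
by rewrite (intS k) addrA.
Qed.

(** The jump into [a] and the old letter at [a] are distributed as if a letter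
    of density [rho] had preceded them in the new configuration; they are
    determined by two old letters and one coin. *)
Lemma joint_entrance_weight n a w : joint (step_window a n.+1 w) =
  (rho * entrance_weight true n.+1 a w + (1 - rho) * entrance_weight false n.+1 a w)%:E.
Proof.
pose e := a - 1.
have ea : e + 1%:Z = a by rewrite /e subrK.
have e0 : e + 0%:Z = e by rewrite addr0.
have ne : e != a by rewrite /e; lia.
have mT := measurable_step_window a n.+1 w.
have piece x y u : joint (step_window a n.+1 w `&` [set z | z.1 e = x] `&`
      [set z | z.2 e = y] `&` [set z | z.1 a = u]) =
    (bernoulli_pmf rho x * trans x u * coin y *
      step_weight n.+1 a [&& x, ~~ u & y] u w)%:E.
  have := joint_step_window n.+1 e 0 (update (fun=> x) a u) (fun=> y) w.
  rewrite chain_weightS chain_weight0 big_ord_recl big_ord0 mulr1 e0 ea.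
  rewrite updateE update_neq//.
  rewrite /jumps ea updateE update_neq// => <-; congr (joint _).
  rewrite !windowS !window0 !setTI /= !e0 !ea updateE update_neq//.
  by apply/seteqP; split=> z /=; tauto.
have mI x y : measurable (step_window a n.+1 w `&` [set z | z.1 e = x] `&`
    [set z | z.2 e = y]).
  apply: measurableI; first (apply: measurableI => //).
    rewrite -[X in measurable X]setTI.
    exact: (measurable_eta e measurableT (I : measurable [set x])).
  rewrite -[X in measurable X]setTI.
  exact: (measurable_xi e measurableT (I : measurable [set y])).
have piece2 x y : joint (step_window a n.+1 w `&` [set z | z.1 e = x] `&`
      [set z | z.2 e = y]) =
    (bernoulli_pmf rho x * coin y * \sum_(u : bool) trans x u *
      step_weight n.+1 a [&& x, ~~ u & y] u w)%:E.
  rewrite (measure_split joint (measurable_eta a) (mI x y)).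
  rewrite [X in (X + _)%E]piece [X in (_ + X)%E]piece -EFinD.
  by apply: (congr1 EFin); rewrite big_bool /=; ring.
rewrite (split4 e e mT) !piece2 -!EFinD; apply: (congr1 EFin).
rewrite /entrance_weight; move: (step_weight n.+1 a) => W; rewrite !big_bool /=.
rewrite /transition /bernoulli_pmf /=; apply/eqP; rewrite -subr_eq0; apply/eqP.
have bal0 : rho * al - (1 - rho) * be = 0 by rewrite balance subrr.
have rel0 : p * al * be - (al + be - 1) = 0 by rewrite rel subrr.
(* The difference of the two sides as a combination of the two relations. *)
transitivity ((rho * al - (1 - rho) * be) *
    (p * W true false w - be * p * W false true w - (p - be * p) * W false false w) +
  (p * al * be - (al + be - 1)) * (rho * (W false true w - W false false w))).
  by ring.
by rewrite bal0 rel0 !mul0r addr0.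
Qed.

Lemma joint_step_windowE a n w :
  joint (step_window a n.+1 w) = (chain_weight rho al be a n w)%:E.
Proof.
rewrite joint_entrance_weight; apply: (congr1 EFin).
rewrite !entrance_weightS /chain_weight -entrance_weightE !mulrA -mulrDl.
by congr (_ * _); case: (w a); rewrite /transition /bernoulli_pmf /=; ring: bal.
Qed.

Lemma chain_invariant : invariant_measure (tasep_kernel p01) mu.
Proof.
move=> A mA.
transitivity (distribution joint step_pair A).
  rewrite /distribution /pushforward /=; apply: eq_integral => eta _.
  rewrite /tasep_kernel /distribution /pushforward /=.
  by congr (coin_law p01 _); apply/seteqP; split=> xi; rewrite /xsection/= inE.
apply: eq_measure_windows mA => a n w.
by rewrite muP -joint_step_windowE.
Qed.
End invariance.

(** * A strong law of large numbers *)
Lemma floor_sqrt_exist : exists r : nat -> nat,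
  forall n, ((r n) ^ 2 <= n < (r n).+1 ^ 2)%N.
Proof.
suff /choice[r rP] : forall n, exists k, (k ^ 2 <= n < k.+1 ^ 2)%N by exists r.
elim=> [|n [k /andP[kn nk]]]; first by exists 0%N.
have [h|h] := ltnP n.+1 (k.+1 ^ 2); first by exists k; rewrite h ltnW.
by exists k.+1; rewrite h /=; lia.
Qed.

Section density_along_squares.
Variables (R : realType) (rho : R) (b : nat -> bool).
Hypothesis rho01 : 0 <= rho <= 1.

Let D n : R := \sum_(i < n) ((b i)%:R - rho).

Let DE n : D n = (occupation b n)%:R - n%:R * rho.
Proof.
rewrite /D big_split /= sumrN sumr_const card_ord natr_sum.
by rewrite -[rho *+ n]mulr_natl.
Qed.

Let D_lipschitz m n : (m <= n)%N -> `|D n| <= `|D m| + (n - m)%:R.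
Proof.
move=> /subnK <-; rewrite addnK; elim: (n - m)%N => [|k IH]; first by rewrite addr0.
rewrite addSn {1}/D big_ord_recr /= -/(D _) -natr1 [leRHS]addrA.
apply: le_trans (ler_normD _ _) _; apply: lerD => //.
have /andP[r0 r1] := rho01.
by rewrite ler_norml; apply/andP; split; case: (b _); rewrite /= ?mulr1n ?mulr0n; lra.
Qed.

(** Along the squares is enough: between [k^2] and [(k+1)^2] the deviation [D]
    moves by at most [2 k], which is negligible against [k^2]. *)
Lemma occupation_density_squares :
  (D (k.+1 ^ 2)%N / (k.+1 ^ 2)%:R) ^+ 2 @[k --> \oo] --> (0 : R) ->
  ((occupation b n)%:R / n%:R : R) @[n --> \oo] --> rho.
Proof.
move=> D0; have [r rP] := floor_sqrt_exist.
have roo : r n @[n --> \oo] --> \oo.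
  apply/cvgnyPge => A; near=> n.
  have nA : (A ^ 2 <= n)%N by near: n; exact: nbhs_infty_ge.
  have /andP[_ nr] := rP n; rewrite leqNgt; apply/negP => rA.
  have : ((r n).+1 ^ 2 <= A ^ 2)%N by rewrite leq_exp2r.
  by lia.
pose g k : R := `|D (k ^ 2)%N / (k ^ 2)%:R| + 2 / k%:R.
have g0 : g k @[k --> \oo] --> (0 : R).
  rewrite -(cvg_shiftS g).
  suff : g k.+1 @[k --> \oo] --> (Num.sqrt 0 + 2 * 0 : R) by rewrite sqrtr0 mulr0 addr0.
  apply: cvgD; last by apply: cvgMr; exact: cvg_harmonic.
  have -> : (fun k => `|D (k.+1 ^ 2)%N / (k.+1 ^ 2)%:R|) =
    (fun k => Num.sqrt ((D (k.+1 ^ 2)%N / (k.+1 ^ 2)%:R) ^+ 2)).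
    by apply/funext => k; rewrite sqrtr_sqr.
  exact: (continuous_cvg _ (@sqrt_continuous R 0) D0).
apply/subr_cvg0/norm_cvg0P.
apply: (@squeeze_cvgr _ _ _ _ (fun=> 0) (g \o r));
  [|exact: cvg_cst|exact: cvg_comp roo g0].
near=> n; rewrite normr_ge0 /=.
have n0 : (0 < n)%N by near: n; exact: nbhs_infty_gt.
have /andP[rn nr] := rP n; set k := r n in rn nr *.
have k0 : (0 < k)%N by case: k nr {rn} => [|//]; rewrite exp1n ltnNge n0.
have kR0 : 0 < k%:R :> R by rewrite ltr0n.
have k2R0 : 0 < (k ^ 2)%:R :> R by rewrite ltr0n expn_gt0 k0.
have -> : (occupation b n)%:R / n%:R - rho = D n / n%:R.
  by rewrite DE; field; rewrite pnatr_eq0 -lt0n.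
rewrite /g !normrM !normfV !normr_nat.
have -> : `|D (k ^ 2)%N| / (k ^ 2)%:R + 2 / k%:R =
    (`|D (k ^ 2)%N| + (2 * k)%:R) / (k ^ 2)%:R.
  by rewrite natrX natrM; field; rewrite gt_eqF.
apply: (@le_trans _ _ (`|D n| / (k ^ 2)%:R)).
  by rewrite ler_wpM2l// lef_pV2 ?ler_nat ?posrE ?ltr0n ?expn_gt0 ?k0.
apply: ler_wpM2r; first by rewrite invr_ge0 ltW.
apply: le_trans (D_lipschitz rn) _.
by rewrite lerD2l ler_nat; lia.
Unshelve. all: by end_near.
Qed.
End density_along_squares.


Section bounded_expectation.
Context d (T : measurableType d) (R : realType) (P : probability T R).

Definition bounded_rv (f : T -> R) : Prop :=
  measurable_fun [set: T] f /\ exists M : R, forall t, `|f t| <= M.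

Lemma bounded_rv_integrable f : bounded_rv f -> P.-integrable [set: T] (EFin \o f).
Proof.
move=> [mf [M fM]]; apply: measurable_bounded_integrable => //.
  by have := probability_setT P; rewrite /= => ->; rewrite ltry.
exists M; split; first exact: num_real.
by move=> x Mx t _; apply: le_trans (fM t) (ltW Mx).
Qed.

Lemma bounded_rvD f g : bounded_rv f -> bounded_rv g -> bounded_rv (fun t => f t + g t).
Proof.
move=> [mf [M fM]] [mg [N gN]]; split; first exact: measurable_funD.
by exists (M + N) => t; apply: le_trans (ler_normD _ _) _; exact: lerD.
Qed.

Lemma bounded_rvM f g : bounded_rv f -> bounded_rv g -> bounded_rv (fun t => f t * g t).
Proof.
move=> [mf [M fM]] [mg [N gN]]; split; first exact: measurable_funM.
by exists (M * N) => t; rewrite normrM ler_pM.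
Qed.

Lemma bounded_rv_cst c : bounded_rv (fun=> c).
Proof. by split; [exact: measurable_cst|exists `|c|]. Qed.

Lemma bounded_rv_bool (b : T -> bool) : measurable_fun [set: T] b ->
  bounded_rv (fun t => (b t)%:R).
Proof.
move=> mb; split; last by exists 1 => t; case: (b t); rewrite ?normr1 ?normr0.
rewrite (_ : (fun _ => _) = (fun t => if b t then 1 else 0)).
  exact: measurable_fun_ifT.
by apply/funext => t; case: (b t).
Qed.

Lemma bounded_rv_sum (f : nat -> T -> R) n : (forall i, bounded_rv (f i)) ->
  bounded_rv (fun t => \sum_(i < n) f i t).
Proof.
move=> bf; elim: n => [|n IH].
  by under eq_fun do rewrite big_ord0; exact: bounded_rv_cst.
by under eq_fun do rewrite big_ord_recr /=; exact: bounded_rvD.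
Qed.

Lemma Rintegral_bool (b : T -> bool) : measurable_fun [set: T] b ->
  \int[P]_t (b t)%:R = fine (P [set t | b t = true]).
Proof.
move=> mb.
have mB : measurable [set t | b t = true].
  by rewrite -[X in measurable X]setTI; have := mb measurableT _ (I : measurable [set true]).
rewrite /Rintegral -[in RHS](setIT [set t | _]) -integral_indic//.
congr fine; apply: eq_integral => t _; rewrite indicE; congr (_%:R%:E).
by case bt : (b t); [rewrite mem_set|rewrite memNset//= bt].
Qed.
End bounded_expectation.

Section strong_law.
Context d (T : measurableType d) (R : realType) (P : probability T R).
Variables (X : nat -> T -> bool) (rho lam : R).
Hypothesis rho01 : 0 <= rho <= 1.
Hypothesis lam1 : `|lam| < 1.
Hypothesis mX : forall i, measurable_fun [set: T] (X i).
Hypothesis meanX : forall i, P [set t | X i t = true] = rho%:E.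
Hypothesis corrX : forall i m,
  P ([set t | X i t = true] `&` [set t | X (i + m)%N t = true]) =
  (rho ^+ 2 + rho * (1 - rho) * lam ^+ m)%:E.

Let Y i t : R := (X i t)%:R - rho.
Let S n t : R := \sum_(i < n) Y i t.
Let V : R := rho * (1 - rho).

Let bX i : bounded_rv (fun t => (X i t)%:R : R).
Proof. exact: bounded_rv_bool. Qed.

Let bY i : bounded_rv (Y i).
Proof. exact: bounded_rvD (bX i) (bounded_rv_cst _ _). Qed.

Let bS n : bounded_rv (S n).
Proof. exact: bounded_rv_sum. Qed.

Let integralD f g : bounded_rv f -> bounded_rv g ->
  \int[P]_t (f t + g t) = \int[P]_t f t + \int[P]_t g t.
Proof. by move=> bf bg; apply: RintegralD => //; exact: bounded_rv_integrable. Qed.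

Let integralZ c f : bounded_rv f -> \int[P]_t (c * f t) = c * \int[P]_t f t.
Proof. by move=> bf; apply: RintegralZl => //; exact: bounded_rv_integrable. Qed.

Let integral_cst1 (c : R) : \int[P]_t c = c.
Proof.
by rewrite Rintegral_cst//; have := probability_setT P; rewrite /= => ->; rewrite mulr1.
Qed.

Let integral_YY i m : \int[P]_t (Y i t * Y (i + m) t) = V * lam ^+ m.
Proof.
have EX j : \int[P]_t (X j t)%:R = rho by rewrite Rintegral_bool// meanX.
pose XX t := X i t && X (i + m) t.
have mXX : measurable_fun [set: T] XX by exact: measurable_and.
have EXX : \int[P]_t (XX t)%:R = rho ^+ 2 + V * lam ^+ m.
  rewrite Rintegral_bool// (_ : [set t | _] =
    [set t | X i t = true] `&` [set t | X (i + m)%N t = true]) ?corrX//.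
  by apply/seteqP; split=> t; rewrite /XX /=; [move=> /andP[]|move=> [-> ->]].
have -> : \int[P]_t (Y i t * Y (i + m) t) =
    \int[P]_t ((XX t)%:R + (- rho * (X i t)%:R + (- rho * (X (i + m) t)%:R + rho ^+ 2))).
  apply: eq_Rintegral => t _; rewrite /Y /XX -mulnb natrM; ring.
have bc (c : R) j : bounded_rv (fun t => c * (X j t)%:R).
  exact: bounded_rvM (bounded_rv_cst T c) (bX j).
have bXX : bounded_rv (fun t => (XX t)%:R : R) by exact: bounded_rv_bool.
have b2 := bounded_rvD (bc (- rho) (i + m)%N) (bounded_rv_cst _ (rho ^+ 2)).
rewrite integralD//; last exact: bounded_rvD.
rewrite integralD// integralD//; last exact: bounded_rv_cst.
rewrite (integralZ _ (bX i)) (integralZ _ (bX (i + m)%N)) !EX EXX integral_cst1.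
by rewrite /V; ring.
Qed.

Let lam_lt1 : 0 < 1 - lam.
Proof. by rewrite subr_gt0; apply: le_lt_trans lam1; exact: ler_norm. Qed.

(** A geometric sum, which stays bounded in n. *)
Let integral_SY n m :
  \int[P]_t (S n t * Y (n + m) t) = V * lam ^+ m.+1 * (1 - lam ^+ n) / (1 - lam).
Proof.
elim: n m => [|n IH] m.
  under eq_Rintegral do rewrite /S big_ord0 mul0r.
  by rewrite Rintegral_cst// expr0 subrr mulr0 !mul0r.
have -> : \int[P]_t (S n.+1 t * Y (n.+1 + m) t) =
    \int[P]_t (S n t * Y (n + m.+1) t + Y n t * Y (n + m.+1) t).
  by apply: eq_Rintegral => t _; rewrite /S big_ord_recr /= mulrDl addSnnS.
rewrite integralD; [|exact: bounded_rvM..].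
rewrite IH integral_YY !exprS; field.
by rewrite gt_eqF.
Qed.

Let K : R := V + 4 * V / (1 - lam).

Let V0 : 0 <= V.
Proof. by have /andP[r0 r1] := rho01; rewrite mulr_ge0// subr_ge0. Qed.

Let integral_S2 n : \int[P]_t (S n t ^+ 2) <= n%:R * K.
Proof.
elim: n => [|n IH].
  under eq_Rintegral do rewrite /S big_ord0 expr0n.
  by rewrite Rintegral_cst// !mul0r.
have -> : \int[P]_t (S n.+1 t ^+ 2) =
    \int[P]_t (S n t ^+ 2 + (2 * (S n t * Y (n + 0) t) + Y n t * Y (n + 0) t)).
  by apply: eq_Rintegral => t _; rewrite /S big_ord_recr /= addn0; ring.
have b0 := bounded_rvM (bS n) (bY (n + 0)).
have b1 := bounded_rvM (bY n) (bY (n + 0)).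
have b2 : bounded_rv (fun t => 2 * (S n t * Y (n + 0) t)).
  exact: bounded_rvM (bounded_rv_cst _ _) b0.
rewrite integralD; [|exact: bounded_rvM (bS n) (bS n)|exact: bounded_rvD].
rewrite integralD// integralZ// integral_YY integral_SY expr0 mulr1 expr1.
rewrite -[n.+1%:R]natr1 [leRHS]mulrDl mul1r; apply: lerD => //.
rewrite /K addrC lerD2l.
have ln k : `|lam ^+ k| <= 1 by rewrite normrX exprn_ile1// ltW.
have l1 : lam * (1 - lam ^+ n) <= 2.
  apply: le_trans (ler_norm _) _; rewrite normrM -[leRHS]mul1r.
  apply: ler_pM => //; first exact: ltW.
  by apply: le_trans (ler_normB _ _) _; rewrite normr1; have := ln n; lra.
rewrite mulrA; apply: ler_wpM2r; first by rewrite invr_ge0 ltW.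
rewrite -(mulrA V) mulrCA [leRHS]mulrC; apply: ler_wpM2l => //; lra.
Qed.

(** The deviation of the number of occupied indices below n has variance at
    most [n K].  Divided by n and squared, its mean is at most [K / k^2] along
    [n = k^2], which is summable.  The sum of these squares is then integrable,
    hence almost everywhere finite, and its terms tend to 0. *)
Lemma slln_geometric_correlations : {ae P, forall t,
  ((occupation (X^~ t) n)%:R / n%:R : R) @[n --> \oo] --> rho}.
Proof.
pose f k t : R := (S (k.+1 ^ 2) t / (k.+1 ^ 2)%:R) ^+ 2.
have bf k : bounded_rv (f k).
  have bq : bounded_rv (fun t => S (k.+1 ^ 2) t / (k.+1 ^ 2)%:R).
    exact: bounded_rvM (bS _) (bounded_rv_cst _ _).
  exact: (bounded_rvM bq bq).
have f0 k t : 0 <= f k t by exact: sqr_ge0.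
have Ef k : \int[P]_t f k t <= K * (k.+1%:R ^+ 2)^-1.
  have -> : \int[P]_t f k t =
      \int[P]_t (((k.+1 ^ 2)%:R ^+ 2)^-1 * (S (k.+1 ^ 2) t) ^+ 2).
    by apply: eq_Rintegral => t _; rewrite /f exprMn exprVn mulrC.
  rewrite integralZ; last exact: bounded_rvM (bS _) (bS _).
  rewrite ler_pdivrMl ?exprn_gt0 ?ltr0n ?expn_gt0//.
  apply: le_trans (integral_S2 _) _.
  have : k.+1%:R != 0 :> R by rewrite pnatr_eq0.
  rewrite natrX; move: k.+1%:R => x x0.
  by rewrite le_eqVlt; apply/orP; left; apply/eqP; field.
have K0 : 0 <= K.
  by apply: addr_ge0 => //; apply: divr_ge0; [exact: mulr_ge0|exact: ltW].
have sum_sq n : \sum_(k < n) (k.+1%:R ^+ 2)^-1 <= 2 :> R.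
  (* Compare with the telescoping sum of 2 / ((k + 1) (k + 2)). *)
  suff : \sum_(k < n) (k.+1%:R ^+ 2)^-1 <= 2 - 2 * n.+1%:R^-1 :> R.
    by move=> /le_trans; apply; rewrite gerBl mulr_ge0// invr_ge0.
  elim: n => [|n IH]; first by rewrite big_ord0 invr1 mulr1 subrr.
  rewrite big_ord_recr /=; apply: le_trans (lerD IH (lexx _)) _.
  rewrite -addrA lerD2l -[n.+2%:R]natr1.
  have x1 : 1 <= n.+1%:R :> R by rewrite ler1n.
  set x := n.+1%:R in x1 *; have x0 : 0 < x by apply: lt_le_trans x1.
  rewrite -subr_ge0.
  have -> : - (2 * (x + 1)^-1) - (- (2 * x^-1) + (x ^+ 2)^-1) =
      (x - 1) / (x ^+ 2 * (x + 1)).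
    by field; rewrite !gt_eqF// addr_gt0.
  by rewrite divr_ge0 ?subr_ge0// mulr_ge0 ?sqr_ge0// addr_ge0// ltW.
have mf k : measurable_fun [set: T] (fun t => (f k t)%:E).
  by apply/measurable_EFinP; case: (bf k).
have f0E k t : (0 <= (f k t)%:E)%E by rewrite lee_fin.
pose g t := (\sum_(k <oo) (f k t)%:E)%E.
have fin : (\int[P]_t g t < +oo)%E.
  rewrite /g integral_nneseries//.
  apply: (@le_lt_trans _ _ (K * 2)%:E); last by rewrite ltry.
  apply: lime_le; first by apply: is_cvg_nneseries => k _ _; exact: integral_ge0.
  apply: nearW => n; rewrite big_mkord.
  apply: (@le_trans _ _ (\sum_(k < n) (K * (k.+1%:R ^+ 2)^-1)%:E)%E).
    apply: lee_sum => k _.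
    rewrite -(@fineK _ (\int[P]_t (f k t)%:E)%E) ?lee_fin; first exact: Ef.
    by apply: integrable_fin_num => //; exact: bounded_rv_integrable.
  by rewrite sumEFin lee_fin -mulr_sumr; apply: ler_wpM2l.
have ig : P.-integrable [set: T] g.
  apply/integrableP; split; first exact: ge0_emeasurable_sum.
  under eq_integral do rewrite gee0_abs ?nneseries_ge0//.
  exact: fin.
apply: filterS (integrable_ae measurableT ig) => t /(_ I) gfin.
apply: (occupation_density_squares rho01); apply: cvg_series_cvg_0 => /=.
apply: nondecreasing_is_cvgn.
  by apply/nondecreasing_seqP => n; rewrite /series /= big_nat_recr //= lerDl sqr_ge0.
exists (fine (g t)) => _ [n _ <-].
rewrite -lee_fin fineK// /series /= -sumEFin.
apply: (@nneseries_lim_ge _ (fun k => (f k t)%:E) xpredT 0%N n) => k _ _; exact: f0E.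
Qed.
End strong_law.

(** * Correlations of the chain *)
Section correlations.
Variables (R : realType) (rho al be : R) (mu : probability config R).
Hypothesis balance : rho * al = (1 - rho) * be.
Hypothesis muP : chain_law rho al be mu.

Let lam := 1 - al - be.

(** The centred occupation is an eigenfunction of the transition matrix, for the
    eigenvalue [1 - al - be]. *)
Lemma chain_prediction m a n w :
  mu (window a n.+1 w `&` [set eta | eta (a + n%:Z + m%:Z) = true]) =
  (chain_weight rho al be a n w * (rho + lam ^+ m * ((w (a + n%:Z))%:R - rho)))%:E.
Proof.
elim: m n w => [|m IH] n w.
  rewrite addr0 expr0 mul1r (addrC rho) subrK.
  case wn: (w (a + n%:Z)); last first.
    rewrite mulr0 (_ : _ `&` _ = set0) ?measure0//.
    by apply/seteqP; split=> // eta [/(_ n (ltnSn _)) /= ->]; rewrite wn.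
  rewrite mulr1 -muP; congr (mu _); apply/seteqP; split=> eta; first by case.
  by move=> H; split=> //=; rewrite H// wn.
set A := _ `&` _.
have mA : measurable A.
  by apply: measurableI; [exact: measurable_window|exact: measurable_occupied].
have an : a + n%:Z + m.+1%:Z = a + n.+1%:Z + m%:Z by lia.
rewrite (measure_split mu (measurable_proj_config (a + n.+1%:Z)) mA) /A an.
set B := [set eta : config | eta (_ + m%:Z) = true].
rewrite !(setIAC (window _ _ _) B) !window_update [X in (X + _)%E]IH [X in (_ + X)%E]IH.
rewrite -EFinD; apply: (congr1 EFin).
rewrite !chain_weight_update !updateE -!mulrA -mulrDr; congr (_ * _).
rewrite exprS; move: (lam ^+ m) => z.
have bal : rho * be = be - rho * al by rewrite balance; ring.
by case: (w _); rewrite /transition /bernoulli_pmf /lam /=; ring: bal.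
Qed.

Lemma chain_density i : mu [set eta | eta i = true] = rho%:E.
Proof.
have := muP i 0 (fun=> true); rewrite chain_weight0 /= => <-; congr (mu _).
by rewrite windowS window0 setTI addr0.
Qed.

Lemma chain_correlation i m :
  mu ([set eta | eta i = true] `&` [set eta | eta (i + m%:Z) = true]) =
  (rho ^+ 2 + rho * (1 - rho) * lam ^+ m)%:E.
Proof.
have := chain_prediction m i 0 (fun=> true).
rewrite windowS window0 setTI addr0 chain_weight0 /= => ->.
by apply: (congr1 EFin); ring.
Qed.
End correlations.

(** * The stationary chain as invariant measure *)
Section stationary_chain.
Variables (R : realType) (rho al be : R).
Hypotheses (rho01 : 0 < rho < 1) (al01 : 0 < al < 1) (be01 : 0 < be < 1).
Hypothesis balance : rho * al = (1 - rho) * be.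
Variables (mu : probability config R) (muP : chain_law rho al be mu).

Let bernoulli_gt0 (q : R) b : 0 < q < 1 -> 0 < bernoulli_pmf q b.
Proof. by move=> /andP[q0 q1]; case: b; rewrite /bernoulli_pmf ?subr_gt0. Qed.

Lemma chain_open_gt0 (U : set config) : open U -> U !=set0 -> (0 < mu U)%E.
Proof.
move=> oU [x Ux]; have [s sx sU] := open_cylinder oU Ux.
have [N sN] := sites_in_window s.
have mU : measurable U by exact: sub_sigma_algebra.
have wU : window (- N%:Z) N.*2.+1 x `<=` U.
  move=> eta H; apply: sU; move: sx; rewrite /cylinder /= => /allP sx.
  apply/allP => q qs; have [k kN qk] := sN q qs.
  by rewrite qk H -?qk ?sx//; lia.
apply: (@lt_le_trans _ _ (mu (window (- N%:Z) N.*2.+1 x))); last first.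
  by apply: le_measure wU; rewrite inE//; exact: measurable_window.
rewrite muP lte_fin mulr_gt0 ?bernoulli_gt0// prodr_gt0// => k _.
rewrite /transition bernoulli_gt0//; case: (x _) => //.
by have /andP[? ?] := al01; rewrite subr_gt0 gtrBl; apply/andP.
Qed.

Lemma chain_has_density : {ae mu, forall eta, has_density eta rho}.
Proof.
have /andP[r0 r1] := rho01; have /andP[a0 a1] := al01; have /andP[b0 b1] := be01.
have rho01' : 0 <= rho <= 1 by rewrite !ltW.
have lam1 : `|1 - al - be| < 1 by rewrite ltr_norml; apply/andP; split; lra.
have right : {ae mu, forall eta : config,
    ((occupation (fun n => eta (Posz n)) n)%:R / n%:R : R) @[n --> \oo] --> rho}.
  apply: (slln_geometric_correlations (X := fun n (eta : config) => eta (Posz n))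
    rho01' lam1).
  - by move=> i; exact: measurable_proj_config.
  - by move=> i; exact: (chain_density muP).
  - by move=> i m; exact: (chain_correlation balance muP (Posz i) m).
have left : {ae mu, forall eta : config,
    ((occupation (fun n => eta (Negz n)) n)%:R / n%:R : R) @[n --> \oo] --> rho}.
  apply: (slln_geometric_correlations (X := fun n (eta : config) => eta (Negz n))
    rho01' lam1).
  - by move=> i; exact: measurable_proj_config.
  - by move=> i; exact: (chain_density muP).
  - move=> i m; rewrite -(chain_correlation balance muP (Negz (i + m)) m) setIC.
    by have -> : Negz (i + m) + m%:Z = Negz i by lia.
by apply: filterS2 right left => eta; exact: has_density_halves.
Qed.
End stationary_chain.

Theorem theorem7 (R : realType) (p : R) (p01 : 0 < p < 1) :
  exists mu : R -> probability config R,
    forall rho : R, 0 < rho < 1 ->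
      [/\ invariant_measure (tasep_kernel p01) (mu rho),
          forall U : set config, open U -> U !=set0 -> (0 < mu rho U)%E &
          {ae mu rho, forall eta, has_density eta rho}].
Proof.
suff /choice[mu muP] : forall rho : R, exists m : probability config R, 0 < rho < 1 ->
    [/\ invariant_measure (tasep_kernel p01) m,
        forall U : set config, open U -> U !=set0 -> (0 < m U)%E &
        {ae m, forall eta, has_density eta rho}] by exists mu.
move=> rho; have [rho01|nrho01] := boolP (0 < rho < 1); last first.
  (* Outside the range of densities any probability will do. *)
  by exists (coin_law p01).
have [al [be [al01 be01 balance key]]] := chain_parameters_exist p01 rho01.
have muP := chain_measureP rho01 al01 be01 balance.
exists (chain_measure rho01 al01 be01) => _; split.
- exact: (chain_invariant p01 balance key muP).
- exact: (chain_open_gt0 rho01 al01 be01 muP).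
- exact: (chain_has_density rho01 al01 be01 balance muP).
Qed.
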